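(* Let $\mathcal{A}$ be a Fréchet algebra. The following statements are equivalent: (i) $\mathcal{A}^{**}$ is Arens regular; (ii) $\mathcal{A}$ and $WAP(\mathcal{A})^*$ are Arens regular; (iii) $\mathcal{A}$ is Arens regular and $WAP(\mathcal{A})^{**}=WAP(\mathcal{A}^{**})$.
   Context: A Fréchet algebra is a complete Hausdorff topological algebra (complex, associative) whose topology is generated by an increasing sequence of submultiplicative seminorms. For a locally convex space $E$, $E^*$ denotes the space of continuous linear functionals with the strong topology (uniform convergence on bounded subsets of $E$); $E^{**}=(E^* )^*$, $E^{***}=(E^{**})^*$, each with its strong topology. The weak topology on $E^*$ is $\sigma(E^*,E^{**})$. For a locally convex algebra $\mathcal{B}$, $f\in\mathcal{B}^*$ and $a\in\mathcal{B}$, put $(a\cdot f)(b)=f(ba)$ and $(f\cdot a)(b)=f(ab)$. $WAP(\mathcal{B})$ is the set of $f\in\mathcal{B}^*$ for which there is a zero neighborhood $U$ in $\mathcal{B}$ such that the weak closure of $\{a\cdot f:a\in U\}$ is weakly compact in $\mathcal{B}^*$. $\mathcal{B}$ is called Arens regular if $WAP(\mathcal{B})=\mathcal{B}^*$. Product on $\mathcal{A}^{**}$: for $f\in\mathcal{A}^*$, $F,G\in\mathcal{A}^{**}$, put $(G\cdot f)(a)=G(f\cdot a)$ for $a\in\mathcal{A}$, and $(F\square G)(f)=F(G\cdot f)$; $\mathcal{A}^{**}$ is regarded as an algebra under $\square$. Product on $WAP(\mathcal{A})^*$: $WAP(\mathcal{A})$ has the topology induced from $\mathcal{A}^*$ and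 is invariant under $f\mapsto f\cdot a$ and $f\mapsto a\cdot f$; for $F,G\in WAP(\mathcal{A})^*$ and $f\in WAP(\mathcal{A})$ put $(G\cdot f)(a)=G(f\cdot a)$ for $a\in\mathcal{A}$ (then $G\cdot f\in WAP(\mathcal{A})$) and $(F\ast G)(f)=F(G\cdot f)$; $WAP(\mathcal{A})^*$ is regarded as an algebra under $\ast$. $WAP(\mathcal{A})^{**}$ is the dual of $WAP(\mathcal{A})^*$. In (iii), Arens regularity of $\mathcal{A}$ means $WAP(\mathcal{A})=\mathcal{A}^*$, so both sides of the equality are subspaces of $\mathcal{A}^{***}$. *)

(* Defs.v *)
From HB Require Import structures.
From mathcomp Require Import all_boot all_order all_algebra.
From mathcomp Require Import all_classical all_reals all_analysis.
From mathcomp.real_closed Require Import complex.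

(* A locally convex space over K is a tvsType K, which the
   library requires to be locally convex; the statement instantiates K with the
   complex numbers R[i], R : realType. *)

Set Implicit Arguments.
Unset Strict Implicit.
Unset Printing Implicit Defensive.

Import Order.TTheory GRing.Theory Num.Theory.
Import numFieldTopology.Exports.

Local Open Scope classical_set_scope.
Local Open Scope ring_scope.

Section TvsFacts.
Context (K : numFieldType) (E F : tvsType K).

Lemma nbhs_shift (G : tvsType K) (x : G) (W : set G) :
  nbhs x W <-> nbhs 0 [set z | W (x + z)].
Proof.
split=> [Wx|W0].
  have := nbhsB (- x) Wx; rewrite addNr; apply: filterS => z [w Ww <-] /=.
  by rewrite addrA subrr add0r.
by have := nbhsT x W0; apply: filterS => z [w Ww <-].
Qed.

Lemma linear_cont0 (f : {linear E -> F}) :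
  (forall U, nbhs 0 U -> nbhs 0 (f @^-1` U)) -> continuous f.
Proof.
move=> f0 x W /nbhs_shift/f0 Wf; apply/nbhs_shift; apply: filterS Wf => z /=.
by rewrite linearD.
Qed.

End TvsFacts.

Section Bounded.
Context (K : numFieldType) (E : tvsType K).

Definition tvs_bounded (S : set E) : Prop :=
  forall U : set E, nbhs 0 U -> exists2 r : K, 0 < r &
    forall t : K, r <= `|t| -> S `<=` [set t *: x | x in U].

Lemma tvs_bounded1 (x : E) : tvs_bounded [set x].
Proof.
move=> U U0; have /= := @scale_continuous K E (0, x) U.
rewrite scale0r => /(_ U0)[[B1 B2] /= [B10 B2x] BU].
have [d /= d0 dB1] : exists2 d : K, 0 < d & forall k, `|k| < d -> B1 k.
  move/nbhs_ballP: B10 => [d /= d0 dB]; exists d => // k kd.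
  by apply: dB; rewrite -ball_normE /= sub0r normrN.
have r0 : 0 < 2 / d by rewrite divr_gt0.
exists (2 / d) => // t rt _ ->.
have t0 : 0 < `|t| by apply: lt_le_trans rt.
have tn0 : t != 0 by rewrite -normr_gt0.
exists (t^-1 *: x); last by rewrite scalerA mulfV// scale1r.
apply: (BU (t^-1, x)); split; last exact: nbhs_singleton.
apply: dB1; rewrite normfV -[d]invrK ltf_pV2 ?posrE ?invr_gt0//.
by apply: lt_le_trans rt; rewrite ltr_pMl ?invr_gt0// ltr1n.
Qed.

Lemma tvs_boundedU (S T : set E) :
  tvs_bounded S -> tvs_bounded T -> tvs_bounded (S `|` T).
Proof.
move=> Sb Tb U U0; have [r r0 rS] := Sb U U0; have [s s0 sT] := Tb U U0.
exists (r + s) => [|t rst x]; first exact: addr_gt0.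
by case=> [/rS|/sT]; apply; apply: le_trans rst; rewrite ?lerDl ?lerDr ltW.
Qed.

Lemma tvs_boundedS (S T : set E) :
  S `<=` T -> tvs_bounded T -> tvs_bounded S.
Proof.
move=> ST Tb U /Tb[r r0 rT]; exists r => // t rt x /ST; exact: rT.
Qed.

End Bounded.

Section DualPred.
Context (K : numFieldType) (E : tvsType K).

Definition lin_cont : {pred E -> K^o} :=
  fun f => `[< linear f /\ continuous f >].

Lemma lin_cont_submod : submod_closed lin_cont.
Proof.
split.
  apply/asboolP; split; last by move=> x; exact: cvg_cst.
  by move=> k x y; rewrite /= scaler0 addr0.
move=> k f g /asboolP[fl fc] /asboolP[gl gc]; apply/asboolP; split.
  move=> c x y; rewrite /= !fctE fl gl /= !scalerDr !scalerA.
  by rewrite addrACA (mulrC k).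
move=> x; rewrite /continuous_at /=; apply: cvgD; last exact: gc.
by apply: cvgZl_tmp; exact: fc.
Qed.

HB.instance Definition _ := GRing.isSubmodClosed.Build _ _ lin_cont lin_cont_submod.

Record dual := Dual { dual_fun :> E -> K^o ; _ : dual_fun \in lin_cont }.
HB.instance Definition _ := [isSub for dual_fun].
HB.instance Definition _ := [Choice of dual by <:].
HB.instance Definition _ := [SubChoice_isSubLmodule of dual by <:].

End DualPred.


Section DualFacts.
Context (K : numFieldType) (E : tvsType K).
Implicit Types f g : dual E.

Lemma dual_linear f : linear f.
Proof. by have /asboolP[] := valP f. Qed.

HB.instance Definition _ f :=
  GRing.isLinear.Build K E K^o *:%R (f : E -> K^o) (dual_linear f).

Lemma dual_cont f : continuous f.
Proof. by have /asboolP[] := valP f. Qed.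

Lemma dualP f g : (forall x, f x = g x) -> f = g.
Proof. by move=> fg; apply/val_inj/funext. Qed.

Lemma dualDE f g x : (f + g) x = f x + g x.
Proof. by []. Qed.

Lemma dualZE k f x : (k *: f) x = k * f x.
Proof. by []. Qed.

Lemma dualNE f x : (- f) x = - f x.
Proof. by []. Qed.

Lemma dual0E x : (0 : dual E) x = 0.
Proof. by []. Qed.

Lemma nbhs0_lt f (e : K) : 0 < e -> nbhs 0 [set x | `|f x| < e].
Proof.
move=> e0; have := @dual_cont f 0; rewrite /continuous_at linear0 => c.
exact: (@cvgr0_norm_lt _ K^o _ _ _ _ c _ e0).
Qed.

Lemma dual_bounded_on f (S : set E) : tvs_bounded S ->
  exists2 M : K, 0 < M & forall x, S x -> `|f x| <= M.
Proof.
move=> /(_ _ (nbhs0_lt f ltr01))[r r0 rS]; exists r => // x.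
move/(rS r); rewrite gtr0_norm// lexx => /(_ isT)[u /= fu <-].
by rewrite linearZ /= normrM gtr0_norm// -[leRHS]mulr1 ler_pM2l// ltW.
Qed.

Lemma lin_cont_bnd (f : {linear E -> K^o}) (V : set E) (M : K) :
  0 < M -> nbhs 0 V -> (forall x, V x -> `|f x| <= M) ->
  (f : E -> K^o) \in @lin_cont K E.
Proof.
move=> M0 V0 VM; apply/asboolP; split; first exact: linearP.
apply: linear_cont0 => U /nbhs_ballP[e /= e0 eU].
have c0 : 0 < e / (2 * M) by rewrite divr_gt0 ?mulr_gt0.
apply: filterS (nbhs0Z (lt0r_neq0 c0) V0) => _ [x Vx <-]; apply: eU.
rewrite -ball_normE /= sub0r normrN linearZ /= normrM gtr0_norm//.
apply: (@le_lt_trans _ _ (e / (2 * M) * M)); first by rewrite ler_pM2l// VM.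
rewrite invfM mulrA mulfVK ?lt0r_neq0//.
by rewrite ltr_pdivrMr// ltr_pMr// ltr1n.
Qed.

End DualFacts.

Section StrongDual.
Context (K : numFieldType) (E : tvsType K).
Implicit Types f g : dual E.

(* The strong topology: uniform convergence on the bounded subsets of E. *)
Definition dual_to_family f : {family @tvs_bounded K E, E -> K^o} := f.

HB.instance Definition _ :=
  Topological.copy (dual E) (initial_topology dual_to_family).

Let strong_filter (h : E -> K^o) : set_system (E -> K^o) :=
  filter_from [set Se : set E * K | tvs_bounded Se.1 /\ 0 < Se.2]
    (fun Se => [set g | forall x, Se.1 x -> `|g x - h x| < Se.2]).

Let strong_filterP (h : E -> K^o) : Filter (strong_filter h).
Proof.
apply: filter_from_filter.
  exists (set0, 1); split => //= U _; exists 1 => // t _ x [].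
move=> [S e] [T d] /= [Sb e0] [Tb d0].
have ed : (e >=< d)%R by rewrite real_comparable ?gtr0_real.
exists (S `|` T, Num.min e d).
  split=> /=; first exact: tvs_boundedU.
  by rewrite comparable_lt_min ?e0.
move=> g /= gh; split=> x /= Sx.
- by have := gh x (or_introl Sx); rewrite comparable_lt_min// => /andP[].
- by have := gh x (or_intror Sx); rewrite comparable_lt_min// => /andP[].
Qed.

Lemma dual_nbhsP f (P : set (dual E)) :
  nbhs f P <-> exists S, exists2 e : K, tvs_bounded S /\ 0 < e &
    forall g, (forall x, S x -> `|g x - f x| < e) -> P g.
Proof.
split=> [[_ /= [[B oB <-] Bf BP]]|[S [e [Sb e0] SP]]].
  have FF := strong_filterP f.
  have cf : {family @tvs_bounded K E, strong_filter f --> dual_to_family f}.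
    apply/fam_cvgP => A Ab W /uniform_nbhs[D [+ DW]].
    rewrite -entourage_ballE => -[d /= d0 dD]; exists (A, d) => //= h hA.
    apply: DW => y Ay; apply: dD; rewrite /= -ball_normE /= distrC.
    exact: hA.
  have [[S e] /= [Sb e0] SeB] := cf _ (open_nbhs_nbhs (conj oB Bf)).
  by exists S, e => // g gS; apply: BP; exact: SeB.
have ent : entourage [set xy : K^o * K^o | `|xy.2 - xy.1| < e].
  rewrite -entourage_ballE; exists e => // -[x y] /=.
  by rewrite -ball_normE /= distrC.
have h : nbhs f [set g : dual E | forall x, S x -> `|g x - f x| < e].
  exact: (@initial_continuous _ _ dual_to_family f _ (fam_nbhs _ ent Sb)).
exact: filterS h.
Qed.

Lemma dual_nbhs0P (P : set (dual E)) :
  nbhs 0 P <-> exists S, exists2 e : K, tvs_bounded S /\ 0 < e &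
    forall g, (forall x, S x -> `|g x| < e) -> P g.
Proof.
have E0 g x : g x - (0 : dual E) x = g x by exact: subr0.
split=> [/dual_nbhsP[S [e Se SP]]|[S [e Se SP]]]; [|apply/dual_nbhsP].
  by exists S, e => // g gS; apply: SP => x Sx; rewrite E0; exact: gS.
by exists S, e => // g gS; apply: SP => x Sx; rewrite -E0; exact: gS.
Qed.

Let dual_add_continuous : continuous (fun z : dual E * dual E => z.1 + z.2).
Proof.
move=> [f g] W /dual_nbhsP[S [e [Sb e0] SW]].
have e20 : 0 < e / 2 by rewrite divr_gt0.
exists ([set h : dual E | forall x, S x -> `|h x - f x| < e / 2],
        [set h : dual E | forall x, S x -> `|h x - g x| < e / 2]).
  by split; apply/dual_nbhsP; exists S, (e / 2).
move=> [f' g'] /= [ff' gg']; apply: SW => x Sx.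
rewrite !dualDE opprD addrACA (le_lt_trans (ler_normD _ _))// [e]splitr.
by rewrite ltrD ?ff' ?gg'.
Qed.

Let dual_scale_continuous : continuous (fun z : K^o * dual E => z.1 *: z.2).
Proof.
move=> [k f] W /dual_nbhsP[S [e [Sb e0] SW]].
have [M M0 fM] := dual_bounded_on f Sb.
have e20 : 0 < e / 2 by rewrite divr_gt0.
have d0 : 0 < e / 2 / (`|k| + 1) by rewrite divr_gt0// ltr_wpDl.
have dM0 : 0 < e / 2 / (M + 1) by rewrite divr_gt0// ltr_wpDl// ltW.
pose N1 := [set l : K^o | `|l - k| < 1 /\ `|l - k| < e / 2 / (M + 1)].
exists (N1, [set h : dual E | forall x, S x -> `|h x - f x| < e / 2 / (`|k| + 1)]).
  split; last by apply/dual_nbhsP; exists S, (e / 2 / (`|k| + 1)).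
  have nb (r : K) : 0 < r -> nbhs (k : K^o) [set l : K^o | `|l - k| < r].
    move=> r0; apply/nbhs_ballP; exists r => // l.
    by rewrite -ball_normE /= distrC.
  by apply: filterI; exact: nb.
move=> [l h] /= [[l1 lM] hf]; apply: SW => x Sx; rewrite !dualZE.
have -> : l * h x - k * f x = l * (h x - f x) + (l - k) * f x.
  by rewrite mulrBr mulrBl addrA subrK.
rewrite (le_lt_trans (ler_normD _ _))// [e]splitr !normrM ltr_leD//.
  apply: (@le_lt_trans _ _ ((`|k| + 1) * `|h x - f x|)).
    rewrite ler_wpM2r// -[l](subrK k) addrC (le_trans (ler_normD _ _))//.
    by rewrite lerD2l ltW.
  by rewrite mulrC -ltr_pdivlMr ?hf// ltr_wpDl.
apply: (@le_trans _ _ (e / 2 / (M + 1) * M)).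
  by rewrite ler_pM ?fM// ltW.
rewrite mulrAC ler_pdivrMr; last by rewrite ltr_wpDl// ltW.
by rewrite ler_pM2l// lerDl.
Qed.

Let open_box f (S : set E) (e : K) :=
  [set g : dual E | exists2 d, 0 < d < e & forall x, S x -> `|g x - f x| <= d].

Let dual_locally_convex : exists2 B : set_system (dual E),
  (forall b, b \in B -> convex_set b) & basis B.
Proof.
exists [set b | open b /\ convex_set b].
  by move=> b; rewrite inE => -[].
split; first by move=> b [].
move=> f W /dual_nbhsP[S [e [Sb e0] SW]].
have half (r : K) : 0 < r -> 0 < r / 2 < r.
  by move=> r0; rewrite divr_gt0// ltr_pdivrMr// ltr_pMr// ltr1n.
exists (open_box f S e); last first.
  move=> g [d /andP[d0 de] gd]; apply: SW => x Sx.
  exact: le_lt_trans (gd _ Sx) de.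
split; last first.
  by exists (e / 2); [exact: half|move=> x _; rewrite subrr normr0 divr_ge0 ?ltW].
split.
  rewrite openE => g [d /andP[d0 de] gd].
  have ed0 : 0 < (e - d) / 2 by rewrite divr_gt0// subr_gt0.
  apply/dual_nbhsP; exists S, ((e - d) / 2) => [//|h hg].
  exists (d + (e - d) / 2).
    have /andP[_ ?] : 0 < (e - d) / 2 < e - d by apply: half; rewrite subr_gt0.
    by rewrite addr_gt0//= -ltrBrDl.
  move=> x Sx; rewrite -(subrK (g x) (h x)) -addrA addrC.
  by rewrite (le_trans (ler_normD _ _))// lerD ?gd// ltW ?hg.
move=> g h l /[!inE] -[d /andP[d0 de] gd] -[c /andP[c0 ce] hc].
have cd : (c >=< d)%R by rewrite real_comparable ?gtr0_real.
exists (Num.max c d).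
  by rewrite comparable_lt_max// c0 comparable_gt_max// ce de.
move=> x Sx.
have -> : (conv l g h : dual E) x - f x =
   l%:num * (g x - f x) + (1 - l%:num) * (h x - f x).
  rewrite !mulrBr addrACA -opprD -mulrDl addrC [_ + (1 - _)]addrC subrK mul1r.
  by rewrite addrC.
have l0 : 0 <= l%:num by [].
have l1 : 0 <= 1 - l%:num by rewrite subr_ge0.
rewrite (le_trans (ler_normD _ _))// !normrM (ger0_norm l0) (ger0_norm l1).
apply: (@le_trans _ _ (l%:num * Num.max c d + (1 - l%:num) * Num.max c d)).
  rewrite lerD// ler_wpM2l//.
    by rewrite comparable_le_max// gd// orbT.
  by rewrite comparable_le_max// hc.
by rewrite -mulrDl addrC subrK mul1r.
Qed.

(* The factory PreTopologicalLmod_isTvs only provides the uniform structure, so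
   the remaining mixins are declared separately. *)
HB.instance Definition _ := PreTopologicalLmod_isTvs.Build K (dual E)
  dual_add_continuous dual_scale_continuous dual_locally_convex.
HB.instance Definition _ :=
  PreTopologicalNmodule_isTopologicalNmodule.Build (dual E) dual_add_continuous.
HB.instance Definition _ :=
  TopologicalNmodule_isTopologicalLmodule.Build K (dual E) dual_scale_continuous.
HB.instance Definition _ := Uniform_isTvs.Build K (dual E) dual_locally_convex.

End StrongDual.

Section DualOfDual.
Context (K : numFieldType) (E : tvsType K).

Lemma lin_contP (f : E -> K^o) (V : set E) (M : K) : linear f ->
  0 < M -> nbhs 0 V -> (forall x, V x -> `|f x| <= M) ->
  f \in @lin_cont K E.
Proof.
move=> fl; pose b := GRing.isLinear.Build _ _ _ _ f fl.
pose F : {linear E -> K^o} := HB.pack f b.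
exact: (@lin_cont_bnd K E F).
Qed.

End DualOfDual.

Section BidualFacts.
Context (K : numFieldType) (E : tvsType K).

Lemma bidual_bnd (F : dual (dual E)) :
  exists S, exists2 M : K, tvs_bounded S /\ 0 < M &
    forall f : dual E, (forall x, S x -> `|f x| <= 1) -> `|F f| <= M.
Proof.
have /dual_nbhs0P[S [e [Sb e0] SF]] := nbhs0_lt F ltr01.
have e20 : 0 < e / 2 by rewrite divr_gt0.
exists S, (e / 2)^-1; first by rewrite invr_gt0.
move=> f fS; have /= := SF ((e / 2) *: f); rewrite linearZ /= normrM gtr0_norm//.
rewrite -ltr_pdivlMl// mulr1 => H; apply/ltW/H => x Sx.
change (`|e / 2 * f x| < e); rewrite normrM gtr0_norm//.
apply: (@le_lt_trans _ _ (e / 2)); first by rewrite ler_piMr ?fS// ltW.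
by rewrite ltr_pdivrMr// ltr_pMr// ltr1n.
Qed.

Lemma bidual_bndS (F : dual (dual E)) :
  exists S, exists2 M : K, tvs_bounded S /\ 0 < M &
    forall (f : dual E) (c : K), 0 < c ->
      (forall x, S x -> `|f x| <= c) -> `|F f| <= M * c.
Proof.
have [S [M SM FM]] := bidual_bnd F; exists S, M => // f c c0 fc.
have /= := FM (c^-1 *: f).
rewrite linearZ /= normrM gtr0_norm ?invr_gt0// mulrC ler_pdivrMr//; apply.
move=> x Sx; change (`|c^-1 * f x| <= 1); rewrite normrM gtr0_norm ?invr_gt0//.
by rewrite mulrC ler_pdivrMr// mul1r fc.
Qed.

Lemma bidualP (F : dual E -> K^o) (S : set E) (M : K) : linear F ->
  tvs_bounded S -> 0 < M ->
  (forall f : dual E, (forall x, S x -> `|f x| <= 1) -> `|F f| <= M) ->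
  F \in @lin_cont K (dual E).
Proof.
move=> Fl Sb M0 FM.
apply: (@lin_contP K (dual E) F [set f : dual E | forall x, S x -> `|f x| < 1] M) => //.
  by apply/dual_nbhs0P; exists S, 1.
by move=> f fS; apply: FM => x /fS /ltW.
Qed.
End BidualFacts.

Section BidualEval.
Context (K : numFieldType) (E : tvsType K).

Lemma bidual_eval_subproof (x : E) :
  (fun f : dual E => f x : K^o) \in @lin_cont K (dual E).
Proof.
apply: (@bidualP K E _ [set x] 1) => //; first exact: tvs_bounded1.
by move=> f; apply.
Qed.

Definition bidual_eval (x : E) : dual (dual E) := Dual (bidual_eval_subproof x).

End BidualEval.

Section Adjoint.
Context (K : numFieldType) (E F : tvsType K).
Variables (T : E -> F) (Tl : linear T) (Tc : continuous T).

Lemma tvs_bounded_image (S : set E) : tvs_bounded S -> tvs_bounded (T @` S).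
Proof.
pose Tlin : {linear E -> F} := HB.pack T (GRing.isLinear.Build _ _ _ _ T Tl).
move=> Sb U U0.
have /Sb[r r0 rS] : nbhs 0 (T @^-1` U).
  have T0 : T 0 = 0 := linear0 Tlin.
  by apply: Tc; rewrite T0.
exists r => // t rt _ [x /(rS t rt)[u Uu <-] <-]; exists (T u) => //.
exact: esym (linearZ_LR Tlin t u).
Qed.

Lemma adjoint_subproof (f : dual F) : (fun x => f (T x)) \in @lin_cont K E.
Proof.
apply/asboolP; split; first by move=> k x y; rewrite Tl linearP.
by move=> x; apply: continuous_comp; [exact: Tc|exact: dual_cont].
Qed.

Definition adjoint (f : dual F) : dual E := Dual (adjoint_subproof f).

Lemma adjointE f x : adjoint f x = f (T x).
Proof. by []. Qed.

Lemma adjoint_linear : linear adjoint.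
Proof. by move=> k f g; apply: dualP. Qed.

Lemma adjoint_continuous : continuous adjoint.
Proof.
move=> f W /dual_nbhsP[S [e [Sb e0] SW]].
apply/dual_nbhsP; exists (T @` S), e; first by split => //; exact: tvs_bounded_image.
by move=> g gS; apply: SW => x Sx; apply: gS; exists x.
Qed.

End Adjoint.

(* As for norms in MathComp, seminorms take their values in K; they are
   nonnegative, hence real when K = R[i]. *)
Definition submul_seminorm (K : numFieldType) (A : lmodType K)
    (m : A -> A -> A) (p : A -> K) : Prop :=
  [/\ forall x, 0 <= p x,
      forall x y, p (x + y) <= p x + p y,
      forall k x, p (k *: x) = `|k| * p x &
      forall x y, p (m x y) <= p x * p y].

(* The product is not assumed to have a unit, so it is not a ring structure.
   Completeness is stated with the additive notion of Cauchy filter, because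
   the uniform structure of a tvsType is not required to be translation
   invariant. *)
HB.mixin Record Tvs_isFrechetAlgebra (K : numFieldType) A & Tvs K A := {
  amul : A -> A -> A ;
  amulA : associative amul ;
  amulDl : left_distributive amul +%R ;
  amulDr : right_distributive amul +%R ;
  amulZl : forall (k : K) x y, amul (k *: x) y = k *: amul x y ;
  amulZr : forall (k : K) x y, amul x (k *: y) = k *: amul x y ;
  frechet_hausdorff : hausdorff_space A ;
  frechet_complete : forall G : set_system A, ProperFilter G ->
    (forall U : set A, nbhs 0 U ->
      exists2 S, G S & forall x y, S x -> S y -> U (x - y)) ->
    exists x : A, G --> x ;
  frechet_seminorms : exists p : nat -> A -> K,
    [/\ forall n, submul_seminorm amul (p n),
        forall n x, p n x <= p n.+1 x &
        forall U : set A, nbhs 0 U <->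
          exists n, exists2 e : K, 0 < e & [set x | p n x < e] `<=` U]
}.

#[short(type="frechetAlgType")]
HB.structure Definition FrechetAlgebra (K : numFieldType) :=
  {A of Tvs_isFrechetAlgebra K A & Tvs K A}.

Section FrechetMul.
Context (K : numFieldType) (A : frechetAlgType K).
Implicit Types (a b : A) (f : dual A) (F G : dual (dual A)).

Lemma amull_linear a : linear (fun b => amul a b).
Proof. by move=> k x y; rewrite amulDr amulZr. Qed.

Lemma amulr_linear a : linear (fun b => amul b a).
Proof. by move=> k x y; rewrite amulDl amulZl. Qed.

Lemma amul_nbhs (U : set A) : nbhs 0 U ->
  exists2 V : set A, nbhs 0 V & forall a b, V a -> V b -> U (amul a b).
Proof.
have [p [pn _ pU]] := @frechet_seminorms K A.
move=> /pU[n [e e0 eU]]; have [p0 _ _ pM] := pn n.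
exists ([set x | p n x < e] `&` [set x | p n x < 1]).
  by apply: filterI; apply/pU; [exists n, e|exists n, 1].
move=> a b [/= ae _] [_ /= b1]; apply: eU => /=.
by rewrite (le_lt_trans (pM _ _))// (le_lt_trans _ ae)// ler_piMr// ltW.
Qed.

Lemma amul_boundedl (S U : set A) : tvs_bounded S -> nbhs 0 U ->
  nbhs 0 [set a | forall s, S s -> U (amul a s)].
Proof.
move=> Sb /amul_nbhs[V V0 VU]; have [r r0 rS] := Sb _ V0.
have := nbhs0Z (r := r^-1) (U := V); rewrite invr_eq0 => /(_ (lt0r_neq0 r0) V0).
apply: filterS => _ [v Vv <-] s /(rS r).
rewrite gtr0_norm// => /(_ (lexx _))[w Vw <-].
by rewrite amulZl amulZr scalerA mulVf ?lt0r_neq0// scale1r; exact: VU.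
Qed.

Lemma amul_boundedr (S U : set A) : tvs_bounded S -> nbhs 0 U ->
  nbhs 0 [set a | forall s, S s -> U (amul s a)].
Proof.
move=> Sb /amul_nbhs[V V0 VU]; have [r r0 rS] := Sb _ V0.
have := nbhs0Z (r := r^-1) (U := V); rewrite invr_eq0 => /(_ (lt0r_neq0 r0) V0).
apply: filterS => _ [v Vv <-] s /(rS r).
rewrite gtr0_norm// => /(_ (lexx _))[w Vw <-].
by rewrite amulZl amulZr scalerA mulfV ?lt0r_neq0// scale1r; exact: VU.
Qed.

Lemma amul_bounded (S T : set A) : tvs_bounded S -> tvs_bounded T ->
  tvs_bounded [set amul s t | s in S & t in T].
Proof.
move=> Sb Tb U /amul_nbhs[V V0 VU].
have [r r0 rS] := Sb _ V0; have [q q0 qT] := Tb _ V0.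
exists (r * q) => [|t rqt _ [x Sx [y Ty <-]]]; first exact: mulr_gt0.
have := rS r; rewrite gtr0_norm// => /(_ (lexx _) _ Sx)[v Vv <-].
have /qT/(_ _ Ty)[w Vw <-] : q <= `|r^-1 * t|.
  rewrite normrM normfV (gtr0_norm r0) [leRHS]mulrC ler_pdivlMr//.
  by rewrite [leLHS]mulrC.
exists (amul v w); first exact: VU.
by rewrite amulZl amulZr scalerA mulrA mulfV ?lt0r_neq0// mul1r.
Qed.

Lemma amull_continuous a : continuous (fun b => amul a b).
Proof.
pose L : {linear A -> A} := HB.pack (fun b => amul a b)
  (GRing.isLinear.Build _ _ _ _ _ (amull_linear a)).
apply: (@linear_cont0 _ _ _ L) => U U0.
by apply: filterS (amul_boundedr (tvs_bounded1 a) U0) => b /(_ _ erefl).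
Qed.

Lemma amulr_continuous a : continuous (fun b => amul b a).
Proof.
pose L : {linear A -> A} := HB.pack (fun b => amul b a)
  (GRing.isLinear.Build _ _ _ _ _ (amulr_linear a)).
apply: (@linear_cont0 _ _ _ L) => U U0.
by apply: filterS (amul_boundedl (tvs_bounded1 a) U0) => b /(_ _ erefl).
Qed.

(* (a . f)(b) = f(ba) and (f . a)(b) = f(ab) *)
Definition lact a f : dual A :=
  adjoint (amulr_linear a) (@amulr_continuous a) f.

Definition ract f a : dual A :=
  adjoint (amull_linear a) (@amull_continuous a) f.

Lemma lactE a f b : lact a f b = f (amul b a). Proof. by []. Qed.

Lemma ractE f a b : ract f a b = f (amul a b). Proof. by []. Qed.

Lemma ract_linear f : linear (ract f).
Proof.
by move=> k x y; apply: dualP => b; rewrite ractE amulDl amulZl linearP.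
Qed.

Lemma ract_continuous f : continuous (ract f).
Proof.
pose L : {linear A -> dual A} := HB.pack (ract f)
  (GRing.isLinear.Build _ _ _ _ _ (ract_linear f)).
apply: (@linear_cont0 _ _ _ L) => U /dual_nbhs0P[S [e [Sb e0] SU]].
by apply: filterS (amul_boundedl Sb (nbhs0_lt f e0)) => a aS; exact: SU.
Qed.

(* (G . f)(a) = G(f . a) *)
Definition bact G f : dual A := adjoint (ract_linear f) (@ract_continuous f) G.

Lemma bactE G f a : bact G f a = G (ract f a). Proof. by []. Qed.

Lemma bact_linear G : linear (bact G).
Proof.
move=> k f g; apply: dualP => a; rewrite bactE.
have -> : ract (k *: f + g) a = k *: ract f a + ract g a by exact: dualP.
by rewrite linearP.
Qed.

Lemma bact_continuous G : continuous (bact G).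
Proof.
pose L : {linear dual A -> dual A} := HB.pack (bact G)
  (GRing.isLinear.Build _ _ _ _ _ (bact_linear G)).
apply: (@linear_cont0 _ _ _ L) => U /dual_nbhs0P[S [e [Sb e0] SU]].
have [T [M [Tb M0] GM]] := bidual_bndS G.
have d0 : 0 < e / (2 * M) by rewrite divr_gt0// mulr_gt0.
apply/dual_nbhs0P; exists [set amul s t | s in S & t in T], (e / (2 * M)).
  by split => //; exact: amul_bounded.
move=> f fST; apply: SU => s Ss.
have : `|G (ract f s)| <= M * (e / (2 * M)).
  by apply: GM => // t Tt; apply/ltW/fST; exists s => //; exists t.
move=> /le_lt_trans; apply.
rewrite mulrC invfM mulrA mulfVK ?lt0r_neq0//.
by rewrite ltr_pdivrMr// ltr_pMr// ltr1n.
Qed.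

(* The product of the bidual: arens F G is f |-> F(G . f). *)
Definition arens F G : dual (dual A) :=
  adjoint (bact_linear G) (@bact_continuous G) F.

Lemma arensE F G f : arens F G f = F (bact G f). Proof. by []. Qed.

End FrechetMul.

Section WeakTopology.
Context (K : numFieldType) (E : tvsType K).

(* The weak topology sigma(E^*, E^** ) on the dual. *)
Definition pairing (f : dual E) : {ptws dual (dual E) -> K^o} := fun F => F f.

Definition weak_dual : Type := initial_topology pairing.
HB.instance Definition _ := Topological.copy weak_dual (initial_topology pairing).

Lemma weak_dual_eval_continuous (F : dual (dual E)) :
  continuous (fun f : weak_dual => F f : K^o).
Proof.
move=> f; apply: (@continuous_comp weak_dual {ptws dual (dual E) -> K^o} K^o
  pairing (fun h => h F)).
  exact: initial_continuous.
exact: (@proj_continuous _ (fun=> K^o) F).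
Qed.

Lemma continuous_weak_dual (T : topologicalType) (h : T -> weak_dual) :
  (forall F : dual (dual E), continuous (fun t => F (h t) : K^o)) ->
  continuous h.
Proof.
move=> hF; apply: (@continuous_comp_initial _ _ _ pairing) => t.
apply/pointwise_cvgP => F; exact: hF.
Qed.

Lemma weak_dual_hausdorff : hausdorff_space weak_dual.
Proof.
move=> f g fg; apply: dualP => x.
have : hausdorff_space K^o by exact: norm_hausdorff.
apply => A B fA gB.
have /= := fg _ _ (@weak_dual_eval_continuous (bidual_eval x) f _ fA)
                 (@weak_dual_eval_continuous (bidual_eval x) g _ gB).
by move=> [h [hA hB]]; exists (h x).
Qed.

End WeakTopology.

Section WAP.
Context (K : numFieldType) (E : tvsType K) (m : E -> E -> E).

(* The set of the a . f for a in U.  It is written with the values of a . f, so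
   that it makes sense for any operation m on E: the continuity of a . f is not
   needed as a side condition (cf. lorbitE for Frechet algebras). *)
Definition lorbit (U : set E) (f : dual E) : set (dual E) :=
  [set g : dual E | exists2 a, U a & forall b, g b = f (m b a)].

Definition WAP : set (dual E) :=
  [set f | exists2 U : set E, nbhs 0 U &
    compact (closure (lorbit U f : set (weak_dual E)))].

Definition arens_regular : Prop := WAP = [set: dual E].

Lemma WAP_sub_compact (f : dual E) (U : set E) (Q : set (weak_dual E)) :
  nbhs 0 U -> compact Q -> lorbit U f `<=` Q -> WAP f.
Proof.
move=> U0 Qc UQ; exists U => //; apply: (subclosed_compact _ Qc).
  exact: closed_closure.
rewrite closureE; apply: smallest_sub => //.
exact: compact_closed (@weak_dual_hausdorff K E) Qc.
Qed.

End WAP.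

Section WAPFrechet.
Context (K : numFieldType) (A : frechetAlgType K).
Implicit Types f g : dual A.

Lemma lorbitE (U : set A) f : lorbit amul U f = [set lact a f | a in U].
Proof.
apply/seteqP; split=> [g [a Ua ga]|_ [a Ua <-]]; last by exists a.
by exists a => //; apply: dualP => b; rewrite ga.
Qed.

Lemma WAP_submod : submod_closed [pred f : dual A | f \in WAP (@amul K A)].
Proof.
split.
  rewrite !inE; apply: (@WAP_sub_compact _ _ _ _ setT [set 0]).
  - exact: filterT.
  - exact: compact_set1.
  - by move=> g [a _ ga]; apply: dualP => b; rewrite ga.
move=> k f g; rewrite !inE => -[U U0 Uc] [V V0 Vc].
pose h (z : weak_dual A * weak_dual A) : weak_dual A :=
  (k *: (z.1 : dual A) + (z.2 : dual A)).
have hc : continuous h.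
  apply: continuous_weak_dual => F.
  have -> : (fun t => F (h t) : K^o) = (fun t => k *: (F t.1 : K^o) + F t.2).
    by apply/funext => t; rewrite /h linearP.
  move=> z; apply: cvgD.
    apply: cvgZl_tmp; apply: (@continuous_comp _ (weak_dual A) K^o fst F).
      exact: cvg_fst.
    exact: weak_dual_eval_continuous.
  apply: (@continuous_comp _ (weak_dual A) K^o snd F).
    exact: cvg_snd.
  exact: weak_dual_eval_continuous.
have hcc := continuous_compact (continuous_subspaceT hc) (compact_setX Uc Vc).
apply: (WAP_sub_compact (filterI U0 V0) hcc) => g' [a [Ua Va] ga].
exists (lact a f, lact a g); last by apply: dualP => b; rewrite ga.
by split; apply: subset_closure; exists a.
Qed.

HB.instance Definition _ := GRing.isSubmodClosed.Build _ _
  [pred f : dual A | f \in WAP (@amul K A)] WAP_submod.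

Record wap := Wap { wap_val :> dual A ;
  _ : wap_val \in [pred f : dual A | f \in WAP (@amul K A)] }.
HB.instance Definition _ := [isSub for wap_val].
HB.instance Definition _ := [Choice of wap by <:].
HB.instance Definition _ := [SubChoice_isSubLmodule of wap by <:].
HB.instance Definition _ := Topological.copy wap (initial_topology wap_val).

Lemma wapP (x : wap) : WAP (@amul K A) x.
Proof. by have := valP x; rewrite inE. Qed.

Lemma wap_valD (x y : wap) : wap_val (x + y) = wap_val x + wap_val y.
Proof. by []. Qed.

Lemma wap_val_linear : linear wap_val.
Proof. by []. Qed.

Lemma wap_val_continuous : continuous wap_val.
Proof. exact: initial_continuous. Qed.

Lemma continuous_wap (T : topologicalType) (h : T -> wap) :
  continuous (fun t => wap_val (h t)) -> continuous h.
Proof. exact: (@continuous_comp_initial _ _ _ wap_val). Qed.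

Let wap_add_continuous : continuous (fun z : wap * wap => z.1 + z.2).
Proof.
apply: continuous_wap => z.
apply: (@continuous_comp _ (dual A * dual A)%type (dual A)
  (fun z : wap * wap => (wap_val z.1, wap_val z.2)) (fun w => w.1 + w.2)).
  apply: (@cvg_pair _ _ _ _ (nbhs (wap_val z.1)) (nbhs (wap_val z.2))).
    apply: (@continuous_comp _ wap (dual A) fst wap_val); first exact: cvg_fst.
    exact: wap_val_continuous.
  apply: (@continuous_comp _ wap (dual A) snd wap_val); first exact: cvg_snd.
  exact: wap_val_continuous.
exact: add_continuous.
Qed.

Let wap_scale_continuous : continuous (fun z : K^o * wap => z.1 *: z.2).
Proof.
apply: continuous_wap => z.
apply: (@continuous_comp _ (K^o * dual A)%type (dual A)
  (fun z : K^o * wap => (z.1, wap_val z.2)) (fun w => w.1 *: w.2)).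
  apply: (@cvg_pair _ _ _ _ (nbhs (z.1 : K^o)) (nbhs (wap_val z.2))); first exact: cvg_fst.
  apply: (@continuous_comp _ wap (dual A) snd wap_val); first exact: cvg_snd.
  exact: wap_val_continuous.
exact: scale_continuous.
Qed.

Let wap_locally_convex : exists2 B : set_system wap,
  (forall b, b \in B -> convex_set b) & basis B.
Proof.
have [B Bc [Bo Bb]] := @locally_convex K (dual A).
exists [set wap_val @^-1` b | b in B].
  move=> _ /[1!inE] -[b Bb' <-] x y l; rewrite !inE /= => xb yb.
  have bB : b \in B by rewrite inE.
  have := @Bc b bB (wap_val x) (wap_val y) l; rewrite !inE => /(_ xb yb).
  by [].
split=> [_ [b Bb' <-]|x W [_ [[V oV <-] Vx VW]]].
  by exists b => //; exact: Bo.
have [b [Bb' bx] bV] := Bb _ _ (open_nbhs_nbhs (conj oV Vx)).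
exists (wap_val @^-1` b); first by split => //; exists b.
by move=> y yb; apply: VW; exact: bV.
Qed.

HB.instance Definition _ := PreTopologicalLmod_isTvs.Build K wap
  wap_add_continuous wap_scale_continuous wap_locally_convex.
HB.instance Definition _ :=
  PreTopologicalNmodule_isTopologicalNmodule.Build wap wap_add_continuous.
HB.instance Definition _ :=
  TopologicalNmodule_isTopologicalLmodule.Build K wap wap_scale_continuous.
HB.instance Definition _ := Uniform_isTvs.Build K wap wap_locally_convex.

End WAPFrechet.

Section WAPDual.
Context (K : numFieldType) (A : frechetAlgType K).
Implicit Types (f : wap A) (a : A) (F G : dual (wap A)).

Let ractl_linear a : linear (fun f : dual A => ract f a).
Proof. by move=> k f g; apply: dualP. Qed.

Let ractl_continuous a : continuous (fun f : dual A => ract f a).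
Proof. exact: adjoint_continuous. Qed.

Lemma wap_ract_subproof f a :
  ract f a \in [pred f : dual A | f \in WAP (@amul K A)].
Proof.
rewrite !inE; have [U U0 Uc] := wapP f.
pose h (g : weak_dual A) : weak_dual A := ract g a.
have hc : continuous h.
  apply: continuous_weak_dual => Phi.
  exact: (@weak_dual_eval_continuous _ _
    (adjoint (ractl_linear a) (@ractl_continuous a) Phi)).
have hcc := continuous_compact (continuous_subspaceT hc) Uc.
apply: (WAP_sub_compact U0 hcc) => g [b Ub gb].
exists (lact b f); first by apply: subset_closure; exists b.
by apply: dualP => c; rewrite gb !ractE lactE amulA.
Qed.

Definition wap_ract f a : wap A := Wap (wap_ract_subproof f a).

Lemma wap_ract_linear f : linear (wap_ract f).
Proof. by move=> k x y; apply: val_inj; exact: ract_linear. Qed.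

Lemma wap_ract_continuous f : continuous (wap_ract f).
Proof. apply: continuous_wap; exact: ract_continuous. Qed.

(* (G . f)(a) = G(f . a), as an element of the dual of A. *)
Definition wap_bact G f : dual A :=
  adjoint (wap_ract_linear f) (@wap_ract_continuous f) G.

Lemma wap_bactE G f a : wap_bact G f a = G (wap_ract f a).
Proof. by []. Qed.

(* The product F * G = (f |-> F(G . f)) of the dual of WAP(A).  The two insubd
   insert G . f into the subtype wap A and f |-> F(G . f) into the dual; their
   default value 0 is never used, since G . f belongs to WAP(A).  For A Arens
   regular, the only case in which this product affects the statement, the
   formula is proved in wap_mulE. *)
Definition wap_mul F G : dual (wap A) :=
  insubd 0 (fun f : wap A => F (insubd 0 (wap_bact G f)) : K^o).

Definition wap_restr : dual (dual A) -> dual (wap A) :=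
  adjoint (@wap_val_linear K A) (@wap_val_continuous K A).

(* The double adjoint of the inclusion of WAP(A) into A^*.  If WAP(A) = A^*, it
   is the identification of WAP(A)^** with a subspace of A^*** . *)
Definition wap_bidual_incl : dual (dual (wap A)) -> dual (dual (dual A)) :=
  adjoint (adjoint_linear (@wap_val_linear K A) (@wap_val_continuous K A))
    (@adjoint_continuous _ _ _ _ (@wap_val_linear K A) (@wap_val_continuous K A)).

Lemma wap_bidual_inclE (Phi : dual (dual (wap A))) (F : dual (dual A)) :
  wap_bidual_incl Phi F = Phi (wap_restr F).
Proof. by []. Qed.

Hypothesis regA : arens_regular (@amul K A).

Let wap_of (f : dual A) : wap A := insubd 0 f.

Let wap_ofK (f : dual A) : wap_val (wap_of f) = f.
Proof. by rewrite [LHS]insubdK// !inE regA. Qed.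

Let wap_of_linear : linear wap_of.
Proof.
move=> k f g; apply: val_inj; rewrite [LHS]wap_ofK.
by rewrite -{1}(wap_ofK f) -{1}(wap_ofK g).
Qed.

Let wap_of_continuous : continuous wap_of.
Proof.
apply: continuous_wap; rewrite [X in continuous X](_ : _ = id); last exact/funext/wap_ofK.
by move=> f; exact: cvg_id.
Qed.

Lemma wap_mulE F G f g : wap_val g = wap_bact G f -> wap_mul F G f = F g.
Proof.
move=> gE.
pose G' : dual (dual A) := adjoint wap_of_linear wap_of_continuous G.
have bE h : wap_bact G h = bact G' h.
  apply: dualP => a; rewrite wap_bactE.
  have -> : wap_ract h a = wap_of (ract h a); last by [].
  by apply: val_inj; rewrite [RHS]wap_ofK.
have FE : (fun h : wap A => F (insubd 0 (wap_bact G h)) : K^o) =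
    adjoint (@wap_val_linear K A) (@wap_val_continuous K A)
      (arens (adjoint wap_of_linear wap_of_continuous F) G').
  by apply/funext => h; rewrite bE.
have -> : wap_mul F G f = F (insubd 0 (wap_bact G f)).
  by rewrite /wap_mul [dual_fun _]insubdK// FE; exact: valP.
have -> : g = insubd 0 (wap_bact G f); last by [].
by apply: val_inj; rewrite [RHS]wap_ofK.
Qed.

End WAPDual.

(* Main.v *)
From HB Require Import structures.
Require Import Defs.
From mathcomp Require Import all_boot all_order all_algebra.
From mathcomp Require Import all_classical all_reals all_analysis.
From mathcomp.real_closed Require Import complex.

(* The canonical map [bidual_eval : A -> A^**] is a continuous algebra morphism
   and its adjoint [A^*** -> A^*] is onto.  Weak almost periodicity pulls back
   along continuous morphisms, so Arens regularity of [A^**] descends to [A].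
   Once [A] is Arens regular, [WAP(A)] is [A^*], so [WAP(A)^*] is [A^**] as an
   algebra and [WAP(A)^**] is the whole of [A^***]; all three statements then
   reduce to the Arens regularity of [A^**]. *)

Import Order.TTheory GRing.Theory Num.Theory.
Import numFieldTopology.Exports.
Local Open Scope classical_set_scope.
Local Open Scope ring_scope.

Section Pullback.
Context (K : numFieldType) (E F : tvsType K).
Variables (mE : E -> E -> E) (mF : F -> F -> F) (T : E -> F).
Hypotheses (Tl : linear T) (Tc : continuous T).
Hypothesis TM : forall x y, T (mE x y) = mF (T x) (T y).
(** [lorbit] holds only continuous functionals; this puts [a . f] in the orbit for every [a] of the
    neighborhood. *)
Hypothesis mF_cont : forall (f : dual F) a,
  exists g : dual F, forall b, g b = f (mF b a).

Lemma WAP_adjoint (f : dual F) : WAP mF f -> WAP mE (adjoint Tl Tc f).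
Proof.
move=> [U U0 Uc].
pose h (g : weak_dual F) : weak_dual E := adjoint Tl Tc g.
have hc : continuous h.
  (* [Phi] composed with the adjoint is the double adjoint of [T] at [Phi], an element of the bidual
     of [F]. *)
  apply: continuous_weak_dual => Phi.
  exact: (@weak_dual_eval_continuous _ _
    (adjoint (adjoint_linear Tl Tc) (@adjoint_continuous _ _ _ _ Tl Tc) Phi)).
have hcc := continuous_compact (continuous_subspaceT hc) Uc.
have T0 : T 0 = 0 by have := Tl (-1) 0 0; rewrite scaler0 addr0 scaleN1r addNr.
have V0 : nbhs 0 (T @^-1` U) by apply: Tc; rewrite T0.
apply: (WAP_sub_compact V0 hcc) => g [a Ua ga].
have [k kE] := mF_cont f (T a).
exists k; first by apply: subset_closure; exists (T a).
by apply: dualP => b; rewrite ga -[LHS]/(k (T b)) kE -TM.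
Qed.

Lemma arens_regular_adjoint :
  (forall g : dual E, exists f : dual F, g = adjoint Tl Tc f) ->
  arens_regular mF -> arens_regular mE.
Proof.
move=> surj regF; apply/seteqP; split=> // g _.
by have [f ->] := surj g; apply: WAP_adjoint; rewrite regF.
Qed.

End Pullback.

(** In the order of [R[i]], [0 <= x] forces [x] to be real, so the Archimedean property of [R]
    applies. *)
Lemma complex_le_nat (R : realType) (x : R[i]) : 0 <= x -> exists n : nat, x <= n.+1%:R.
Proof.
case: x => a b; rewrite lecE /= => /andP[/eqP-> a0].
have [n an] : exists n : nat, a < n%:R.
  by exists (Num.bound a); exact: archi_boundP.
exists n; rewrite -(rmorph_nat (real_complex R)) lecR; apply: le_trans (ltW an) _.
by rewrite ler_nat.
Qed.

Lemma bidual_eval_linear (K : numFieldType) (E : tvsType K) : linear (@bidual_eval _ E).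
Proof. by move=> k x y; apply: dualP => f; exact: (dual_linear f). Qed.

Section BidualEvalContinuous.
Context (R : realType) (A : frechetAlgType R[i]).

(** Metrizable spaces are quasi-barrelled: as the seminorms form a sequence, a failure of
    equicontinuity can be concentrated on one bounded sequence. *)
Lemma bounded_dual_equicontinuous (B : set (dual A)) (e : R[i]) :
  tvs_bounded B -> 0 < e ->
  nbhs 0 [set x : A | forall f, B f -> `|f x| < e].
Proof.
move=> Bb e0; have [p [pn pS pU]] := @frechet_seminorms _ A.
have p0 n x : 0 <= p n x by have [] := pn n.
have pZ n k x : p n (k *: x) = `|k| * p n x by have [] := pn n.
have p_mono m n x : (m <= n)%N -> p m x <= p n x.
  elim: n => [|n IHn]; first by rewrite leqn0 => /eqP->.
  by rewrite leq_eqVlt => /predU1P[->//|/IHn/le_trans]; apply.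
(* Otherwise pick x_n with p_n(x_n) < (n+1)^-2 and f_n in B with
   e <= |f_n(x_n)|: then y_n = (n+1) x_n is a bounded sequence, yet
   (n+1) e <= |f_n(y_n)| contradicts the boundedness of B. *)
apply/pU; apply: contrapT => /forallNP noN.
have wit n : exists xf : A * dual A,
    [/\ p n xf.1 < n.+1%:R ^- 2, B xf.2 & e <= `|xf.2 xf.1| ].
  apply: contrapT => /forallNP H; apply: (noN n); exists (n.+1%:R ^- 2).
    by rewrite invr_gt0 exprn_gt0 ?ltr0n.
  move=> x /= px f Bf; rewrite (real_ltNge (normr_real _) (gtr0_real e0)).
  by apply/negP => ex; apply: (H (x, f)).
have {wit} [xf xfP] := choice wit.
pose y n : A := n.+1%:R *: (xf n).1.
have yb : tvs_bounded (range y).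
  move=> U /pU[N [d d0 dU]].
  (* The sum covers the indices below [N]; from [N] on, [p N (y n) <= p n (y n) <= (n+1) (n+1)^-2 <=
     1]. *)
  pose M := 1 + \sum_(i < N) p N (y i).
  have M0 : 0 < M by rewrite ltr_pwDl// sumr_ge0.
  have yM n : p N (y n) <= M.
    have [nN|Nn] := ltnP n N.
      by rewrite /M (bigD1 (Ordinal nN))//= addrCA lerDl addr_ge0// sumr_ge0//.
    apply: (le_trans (p_mono _ _ (y n) Nn)).
    apply: (@le_trans _ _ 1); last by rewrite lerDl sumr_ge0.
    have [/ltW pxn _ _] := xfP n.
    rewrite pZ normr_nat mulrC -ler_pdivlMr ?ltr0n// mul1r.
    apply: (le_trans pxn); rewrite lef_pV2 ?posrE ?exprn_gt0 ?ltr0n//.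
    by rewrite expr2 ler_pMr ?ltr0n// ler1n.
  have r0 : 0 < (M + 1) / d by rewrite divr_gt0// addr_gt0.
  exists ((M + 1) / d) => // t rt _ [n _ <-].
  have t0 : 0 < `|t| by apply: lt_le_trans rt.
  exists (t^-1 *: y n); last by rewrite scalerA mulfV -?normr_gt0// scale1r.
  apply: dU => /=; rewrite pZ normfV mulrC ltr_pdivrMr//.
  apply: (le_lt_trans (yM n)); apply: (@lt_le_trans _ _ (M + 1)).
    by rewrite ltrDl.
  by rewrite mulrC -ler_pdivrMr.
have W0 : nbhs 0 [set g : dual A | forall x, range y x -> `|g x| < e].
  by apply/dual_nbhs0P; exists (range y), e.
have [r r0 rB] := Bb _ W0; have [n rn] := complex_le_nat _ r (ltW r0).
have := rB n.+1%:R; rewrite normr_nat => /(_ rn).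
have [_ Bf ef] := xfP n => /(_ _ Bf)[g gy gE].
have /= := gy (y n) (imageP _ I).
(* The factor [n.+1] moves from the functional to its argument. *)
have -> : g (y n) = (xf n).2 (xf n).1 by rewrite -gE dualZE /y linearZ.
by move=> /lt_le_trans/(_ ef); rewrite ltxx.
Qed.

(** Zero neighborhoods of the bidual come from strongly bounded sets of functionals, which are
    equicontinuous. *)
Lemma bidual_eval_continuous : continuous (@bidual_eval _ A).
Proof.
pose L : {linear A -> dual (dual A)} := HB.pack (@bidual_eval _ A)
  (GRing.isLinear.Build _ _ _ _ _ (bidual_eval_linear _ A)).
apply: (@linear_cont0 _ _ _ L) => U /dual_nbhs0P[S [e [Sb e0] SU]].
by apply: filterS (bounded_dual_equicontinuous _ _ Sb e0) => x xS; exact: SU.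
Qed.

End BidualEvalContinuous.

Section ArensProduct.
Context (K : numFieldType) (A : frechetAlgType K).

Lemma bidual_eval_amul (a b : A) :
  bidual_eval (amul a b) = arens (bidual_eval a) (bidual_eval b).
Proof. exact: dualP. Qed.

(** [F |-> arens F G] is the adjoint of [bact G], hence strongly continuous. *)
Lemma arens_contl (Phi : dual (dual (dual A))) (G : dual (dual A)) :
  exists Psi : dual (dual (dual A)), forall F, Psi F = Phi (arens F G).
Proof.
by exists (adjoint (adjoint_linear (@bact_linear _ _ G) (@bact_continuous _ _ G))
  (@adjoint_continuous _ _ _ _ (@bact_linear _ _ G) (@bact_continuous _ _ G)) Phi).
Qed.

End ArensProduct.

Lemma arens_regular_bidual (R : realType) (A : frechetAlgType R[i]) :
  arens_regular (@arens _ A) -> arens_regular (@amul _ A).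
Proof.
apply: (arens_regular_adjoint _ _ _ _ _ _ (bidual_eval_linear _ A)
  (bidual_eval_continuous _ A) (bidual_eval_amul _ A) (arens_contl _ A)).
(* Evaluation at [f], restricted to the image of [A], is [f] itself. *)
by move=> f; exists (bidual_eval f); exact: dualP.
Qed.

Section WapRegular.
Context (K : numFieldType) (A : frechetAlgType K).
Hypothesis regA : arens_regular (@amul K A).

(** Under [regA] the default value 0 is never taken. *)
Definition wap_of (f : dual A) : wap A := insubd 0 f.

Lemma wap_ofK (f : dual A) : wap_val (wap_of f) = f.
Proof. by rewrite [LHS]insubdK// !inE regA. Qed.

Lemma wap_valK (f : wap A) : wap_of (wap_val f) = f.
Proof. by apply: val_inj; exact: wap_ofK. Qed.

Lemma wap_of_linear : linear wap_of.
Proof.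
move=> k f g; apply: val_inj; rewrite [LHS]wap_ofK.
by rewrite -{1}(wap_ofK f) -{1}(wap_ofK g).
Qed.

Lemma wap_of_continuous : continuous wap_of.
Proof.
apply: continuous_wap; rewrite [X in continuous X](_ : _ = id); last exact/funext/wap_ofK.
by move=> f; exact: cvg_id.
Qed.

Definition wap_ext : dual (wap A) -> dual (dual A) :=
  adjoint wap_of_linear wap_of_continuous.

Definition wap_ext_linear : linear wap_ext :=
  adjoint_linear wap_of_linear wap_of_continuous.

Definition wap_ext_continuous : continuous wap_ext :=
  @adjoint_continuous _ _ _ _ wap_of_linear wap_of_continuous.

Definition wap_restr_linear : linear (@wap_restr K A) :=
  adjoint_linear (@wap_val_linear K A) (@wap_val_continuous K A).

Definition wap_restr_continuous : continuous (@wap_restr K A) :=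
  @adjoint_continuous _ _ _ _ (@wap_val_linear K A) (@wap_val_continuous K A).

Lemma wap_extK G : wap_restr (wap_ext G) = G.
Proof.
by apply: dualP => f; rewrite -[LHS]/(G (wap_of (wap_val f))) wap_valK.
Qed.

Lemma wap_restrK F : wap_ext (wap_restr F) = F.
Proof.
by apply: dualP => f; rewrite -[LHS]/(F (wap_val (wap_of f))) wap_ofK.
Qed.

Lemma wap_ext_mul F G : wap_ext (wap_mul F G) = arens (wap_ext F) (wap_ext G).
Proof.
apply: dualP => f; rewrite -[LHS]/(wap_mul F G (wap_of f)).
rewrite -[RHS]/(F (wap_of (bact (wap_ext G) f))).
apply: wap_mulE => //; rewrite wap_ofK; apply: dualP => a.
rewrite wap_bactE bactE -[LHS]/(G (wap_of (ract f a))); congr (G _).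
by apply: val_inj; rewrite /= wap_ofK; apply: dualP => b; rewrite !ractE wap_ofK.
Qed.

Lemma wap_restr_arens (F G : dual (dual A)) :
  wap_restr (arens F G) = wap_mul (wap_restr F) (wap_restr G).
Proof. by rewrite -[RHS]wap_extK wap_ext_mul !wap_restrK. Qed.

Lemma wap_bidual_incl_surj (Phi : dual (dual (dual A))) :
  exists Psi, wap_bidual_incl Psi = Phi.
Proof.
exists (adjoint wap_ext_linear wap_ext_continuous Phi).
by apply: dualP => F; rewrite -[LHS]/(Phi (wap_ext (wap_restr F))) wap_restrK.
Qed.

(** [insubd] hides the adjoint inside [wap_mul], so the functional is built for [arens] and carried
    over by [wap_ext]. *)
Lemma wap_mul_contl (Phi : dual (dual (wap A))) (G : dual (wap A)) :
  exists Psi : dual (dual (wap A)), forall F, Psi F = Phi (wap_mul F G).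
Proof.
have [Psi PsiE] := arens_contl _ _ (wap_bidual_incl Phi) (wap_ext G).
exists (adjoint wap_ext_linear wap_ext_continuous Psi) => F.
by rewrite -[LHS]/(Psi (wap_ext F)) PsiE -wap_ext_mul wap_bidual_inclE wap_extK.
Qed.

(** [wap_ext] and [wap_restr] are mutually inverse continuous morphisms; pulling back along each
    gives one implication. *)
Lemma arens_regular_wap :
  arens_regular (@arens K A) <-> arens_regular (@wap_mul K A).
Proof.
split.
  apply: (arens_regular_adjoint _ _ _ _ _ _ wap_ext_linear wap_ext_continuous
    wap_ext_mul (arens_contl _ A)) => Phi.
  exists (wap_bidual_incl Phi).
  by apply: dualP => F; rewrite -[RHS]/(Phi (wap_restr (wap_ext F))) wap_extK.
apply: (arens_regular_adjoint _ _ _ _ _ _ wap_restr_linear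
  wap_restr_continuous wap_restr_arens wap_mul_contl) => Phi.
by have [Psi <-] := wap_bidual_incl_surj Phi; exists Psi; exact: dualP.
Qed.

Lemma range_wap_bidual_incl :
  range (@wap_bidual_incl K A) = [set: dual (dual (dual A))].
Proof.
apply/seteqP; split=> // Phi _.
by have [Psi <-] := wap_bidual_incl_surj Phi; exists Psi.
Qed.

End WapRegular.

Theorem proposition3p9 (R : realType) (A : frechetAlgType R[i]) :
  (arens_regular (@arens R[i] A) <->
     arens_regular (@amul R[i] A) /\ arens_regular (@wap_mul R[i] A)) /\
  (arens_regular (@arens R[i] A) <->
     arens_regular (@amul R[i] A) /\
     range (@wap_bidual_incl R[i] A) = WAP (@arens R[i] A)).
Proof.
split; split.
- move=> regAA; have regA := arens_regular_bidual _ _ regAA.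
  by split=> //; exact/(arens_regular_wap _ _ regA).
- by move=> [regA] /(arens_regular_wap _ _ regA).
- move=> regAA; have regA := arens_regular_bidual _ _ regAA.
  by split=> //; rewrite range_wap_bidual_incl// regAA.
(* With [A] regular the range is the whole third dual, so the equality in (iii) is regularity of the
   bidual. *)
- by move=> [regA incE]; rewrite /arens_regular -incE range_wap_bidual_incl.
Qed.
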